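(* Let $A$ be a Noetherian ring and $M$ a finitely generated $A$-module contained in a free $A$-module $F$ of finite rank $r>0$. Suppose that $M$ is a faithful $A$-module. Then the following assertions hold. (1) $\widetilde{M^n}=(\widetilde M)^n=M^n$ for every $n\gg 0$. (2) Let $N$ be an $A$-submodule of $F$ such that $M\subseteq N$. Then the following conditions are equivalent. (i) $N\subseteq\widetilde M$. (ii) $M^{\ell}=N^{\ell}$ for some $\ell>0$. (iii) $M^n=N^n$ for every $n\gg 0$. (iv) $\widetilde M=\widetilde N$. (3) $\widetilde M$ is Ratliff–Rush closed, i.e. $\widetilde{\widetilde M}=\widetilde M$.
   Context: Let $S=\operatorname{Sym}_A(F)\cong A[t_1,\dots,t_r]$ with its standard grading and $F^n=S_n$. For an $A$-submodule $N\subseteq F$, the Rees algebra is $\mathcal R(N)=\operatorname{Im}(\operatorname{Sym}_A(N)\to S)$ and $N^n=[\mathcal R(N)]_n\subseteq F^n$ (the $A$-span in $S_n$ of products of $n$ elements of $N$). The Ratliff–Rush closure of $N^n$ (with respect to $F$) is $$\widetilde{N^n}=\bigcup_{\ell>0}\left[(N^n)^{\ell+1}:_{F^n}(N^n)^{\ell}\right]\subseteq F^n,$$ i.e. the set of $x\in F^n$ with $x(N^n)^\ell\subseteq (N^n)^{\ell+1}$ for some $\ell>0$, products taken in $S$; in particular $\widetilde N=\bigcup_{\ell>0}[N^{\ell+1}:_F N^\ell]$. It is an $A$-submodule of $F^n$ containing $N^n$. *)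

(* Defs.v *)
From mathcomp Require Export all_boot all_algebra.
From mathcomp Require Export classical_sets.
From mathcomp Require Export mpoly.

#[global] Set Implicit Arguments.
#[global] Unset Strict Implicit.
#[global] Unset Printing Implicit Defensive.

Import GRing.Theory.
Local Open Scope classical_set_scope.
Local Open Scope ring_scope.

Definition is_submodule (A : comNzRingType) (V : lmodType A) (N : set V) :=
  N 0 /\ forall (a : A) (x y : V), N x -> N y -> N (a *: x + y).

Definition span (A : comNzRingType) (V : lmodType A) (X : set V) : set V :=
  [set v | exists (k : nat) (c : 'I_k -> A) (x : 'I_k -> V),
    (forall i, X (x i)) /\ v = \sum_i c i *: x i].

Definition fin_gen (A : comNzRingType) (V : lmodType A) (N : set V) :=
  exists s : seq V, N = span [set x | x \in s].

(* Ideals of A are the submodules of the regular module A^o. *)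
Definition noetherian (A : comNzRingType) :=
  forall I : set A^o, is_submodule I -> fin_gen I.

Definition faithful (A : comNzRingType) (V : lmodType A) (N : set V) :=
  forall a : A, (forall x, N x -> a *: x = 0) -> a = 0.

Section PolynomialSubmodules.
Variables (A : comNzRingType) (r : nat).
Local Notation S := {mpoly A[r]}.

Definition pow (P : set S) (n : nat) : set S :=
  span [set p | exists f : 'I_n -> S, (forall i, P (f i)) /\ p = \prod_i f i].

Definition colon (n : nat) (P Q : set S) : set S :=
  [set x | x \is n.-homog /\ forall y, Q y -> P (x * y)].

Definition ratliff_rush (n : nat) (P : set S) : set S :=
  [set x | exists2 l : nat, (0 < l)%N & colon n (pow P l.+1) (pow P l) x].

End PolynomialSubmodules.

(* A free module F of rank r comes with an isomorphism phi : F -> A^r (its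
   inverse is a choice of basis); Sym_A(F) is then A[t_1, ..., t_r], with F
   embedded as the linear forms by lin_form phi.  The submodules of F and their
   Ratliff-Rush closures live in F, their powers in A[t_1, ..., t_r]. *)
Section FreeModule.
Variables (A : comNzRingType) (r : nat) (F : lmodType A).
Variable phi : {linear F -> 'rV[A]_r}.

Definition lin_form (x : F) : {mpoly A[r]} := \sum_(i < r) phi x 0 i *: 'X_i.

Definition mod_pow (N : set F) (n : nat) : set {mpoly A[r]} :=
  pow (lin_form @` N) n.

Definition mod_ratliff_rush (N : set F) : set F :=
  lin_form @^-1` ratliff_rush 1 (lin_form @` N).

End FreeModule.

(* Main.v *)
(* Write R for the Rees algebra of M and, for n > 0, let E_n be the set of forms
   y of degree n with y M^k in M^{n+k} for some k; then E_n is the Ratliff-Rush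
   closure of M^n, and E_m E_n lies in E_{m+n}.  The point is that E_n = M^n for
   all large n.  By descending induction on k it suffices that, for large n, a
   form z of degree n with z M in M^{n+1} lies in M^n.  Such forms are in the
   R-module Z = { z | z M in R }, which embeds in a power of R because M, being
   faithful, has no nonzero annihilator in Sym(F) (McCoy); as R is noetherian, Z
   is finitely generated, and its generators are of bounded degree.  Finally, if
   N lies in the closure E_1 of M, then N^n lies in E_n = M^n for large n. *)
Require Import Defs.
From mathcomp Require Import boolp.
Import GRing.Theory.
Local Open Scope classical_set_scope.
Local Open Scope ring_scope.

(** * Submodules and the Hilbert basis theorem *)

Lemma uniform_bound (T : eqType) (s : seq T) (Q : nat -> T -> Prop) :
  (forall m n x, (m <= n)%N -> Q m x -> Q n x) ->
  (forall x, x \in s -> exists n, Q n x) -> exists n, forall x, x \in s -> Q n x.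
Proof.
move=> mono; elim: s => [|x s IH] h; first by exists 0%N.
have [|n hn] := IH; first by move=> y ys; apply: h; rewrite inE ys orbT.
have [m hm] := h x (mem_head _ _).
exists (maxn m n) => y; rewrite inE => /predU1P[->|/hn].
  by apply: mono hm; apply: leq_maxl.
by apply: mono; apply: leq_maxr.
Qed.

Section Submodules.
Variables (A : comNzRingType) (V : lmodType A).
Implicit Types (N X : set V).

Lemma submod_add N x y : is_submodule N -> N x -> N y -> N (x + y).
Proof. by case=> _ hN Nx Ny; rewrite -[x]scale1r; apply: hN. Qed.

Lemma submod_scale N a x : is_submodule N -> N x -> N (a *: x).
Proof. by case=> N0 hN Nx; rewrite -[_ *: _]addr0; apply: hN. Qed.

Lemma submod_sub N x y : is_submodule N -> N x -> N y -> N (x - y).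
Proof. by case=> _ hN Nx Ny; rewrite addrC -scaleN1r; apply: hN. Qed.

Lemma submod_sum N (I : Type) (s : seq I) (P : pred I) (f : I -> V) :
  is_submodule N -> (forall i, P i -> N (f i)) -> N (\sum_(i <- s | P i) f i).
Proof.
by move=> hN h; elim/big_ind: _ => //; [case: hN | move=> x y; apply: submod_add].
Qed.

Lemma submod_setI N N' :
  is_submodule N -> is_submodule N' -> is_submodule (N `&` N').
Proof.
move=> [N0 hN] [N'0 hN']; split=> // a x y [Nx N'x] [Ny N'y].
by split; [apply: hN | apply: hN'].
Qed.

Lemma span_submod X : is_submodule (span X).
Proof.
split; first by exists 0, (fun=> 0), (fun=> 0); split; [case | rewrite big_ord0].
move=> a _ _ [k [c [x [Xx ->]]]] [l [d [y [Xy ->]]]].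
exists (k + l)%N, (fun i => match split i with inl j => a * c j | inr j => d j end).
exists (fun i => match split i with inl j => x j | inr j => y j end); split.
  by move=> i; case: (split i).
rewrite big_split_ord scaler_sumr; congr (_ + _); apply: eq_bigr => i _.
  by case: split_ordP => j /eqP; rewrite (eq_lshift, eq_lrshift) // => /eqP ->; rewrite scalerA.
by case: split_ordP => j /eqP; rewrite (eq_rshift, eq_rlshift) // => /eqP ->.
Qed.

Lemma sub_span X : X `<=` span X.
Proof.
by move=> x Xx; exists 1%N, (fun=> 1), (fun=> x); split; rewrite // big_ord1 scale1r.
Qed.

Lemma span_min X N : is_submodule N -> X `<=` N -> span X `<=` N.
Proof.
move=> hN XN _ [k [c [x [Xx ->]]]].
by apply: submod_sum => // i _; apply: submod_scale => //; apply: XN.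
Qed.

Lemma span_mono X Y : X `<=` Y -> span X `<=` span Y.
Proof.
move=> XY; apply: span_min; first exact: span_submod.
by move=> x Xx; apply/sub_span/XY.
Qed.

End Submodules.

Lemma ker_submod (A : comNzRingType) (V W : lmodType A) (f : V -> W) : linear f ->
  is_submodule [set x | f x = 0].
Proof.
move=> lin; split=> [|a x y /= fx fy] /=; last by rewrite lin fx fy scaler0 addr0.
by have := lin (-1) 0 0; rewrite scaler0 addr0 scaleN1r addNr.
Qed.

Lemma image_submod (A : comNzRingType) (V W : lmodType A) (f : V -> W) (N : set V) : linear f ->
  is_submodule N -> is_submodule (f @` N).
Proof.
move=> lin [N0 hN]; split; first by exists 0; rewrite //; case: (ker_submod lin).
by move=> a _ _ [x Nx <-] [y Ny <-]; exists (a *: x + y); [apply: hN | rewrite lin].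
Qed.

Lemma image_span (A : comNzRingType) (V W : lmodType A) (f : V -> W) (X : set V) :
  linear f -> f @` span X = span (f @` X).
Proof.
move=> lin; apply/seteqP; split; last first.
  apply: span_min; first exact/(image_submod lin)/span_submod.
  by apply: image_subset; apply: sub_span.
move=> _ [x Xx <-]; have hT := span_submod (f @` X).
have hf : is_submodule (f @^-1` span (f @` X)).
  split; first by rewrite /= (ker_submod lin).1; case: hT.
  by move=> a y z /= hy hz; rewrite lin; case: hT => _; apply.
by apply: (span_min hf) Xx => y Xy; apply: sub_span; exists y.
Qed.

Section Noetherian.
Variable A : comNzRingType.
Hypothesis noethA : noetherian A.

(** Lifts to [N] of generators of the image generate it together with generators of the kernel:
    subtracting from [x] a combination of lifts with the same image leaves a kernel element. *)
Lemma fin_gen_extension (V W : lmodType A) (f : V -> W) (N : set V) :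
  linear f -> is_submodule N -> fin_gen (f @` N) -> fin_gen (N `&` [set x | f x = 0]) ->
  fin_gen N.
Proof.
move=> lin hN [s1 e1] [s2 e2].
have [s [sN s1s]] : exists s : seq V, (forall x, x \in s -> N x) /\
    forall a, a \in s1 -> exists2 x, x \in s & f x = a.
  have : forall a, a \in s1 -> (f @` N) a by move=> a as1; rewrite e1; apply: sub_span.
  elim: s1 {e1} => [|a s1 IH] h; first by exists [::].
  have [s [sN s1s]] : exists s : seq V, (forall x, x \in s -> N x) /\
    forall a, a \in s1 -> exists2 x, x \in s & f x = a.
    by apply: IH => b bs1; apply: h; rewrite inE bs1 orbT.
  have [x Nx fx] := h a (mem_head _ _).
  exists (x :: s); split=> y; rewrite inE => /predU1P[-> //|]; first exact: sN.
    by exists x; rewrite ?mem_head.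
  by move=> /s1s[z zs <-]; exists z; rewrite // inE zs orbT.
exists (s ++ s2); apply/seteqP; split; last first.
  apply: span_min => // x /=; rewrite mem_cat => /orP[/sN//|xs2].
  by have : span [set x | x \in s2] x by [exact: sub_span]; rewrite -e2 => -[].
move=> x Nx.
have [u us fu] : (f @` span [set x | x \in s]) (f x).
  have : (f @` N) (f x) by exists x.
  rewrite e1; apply: span_min; first exact/(image_submod lin)/span_submod.
  by move=> a /s1s[y ys <-]; exists y => //; apply: sub_span.
have uN : N u by apply: span_min us.
have : (N `&` [set x | f x = 0]) (x - u).
  by split; [apply: submod_sub | rewrite /= addrC -scaleN1r lin fu scaleN1r addNr].
rewrite e2 => xus2; rewrite -(subrK u x).
apply: submod_add; first exact: span_submod.
  by apply: span_mono xus2 => y /= ys2; rewrite mem_cat ys2 orbT.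
by apply: span_mono us => y /= ys; rewrite mem_cat ys.
Qed.

(** By induction on [k]: the image of [N] under the last functional is an ideal of [A], and on its
    kernel the others remain jointly injective. This serves both for rows and for polynomials of
    bounded degree. *)
Lemma fin_gen_functionals (V : lmodType A) (k : nat)
    (f : nat -> V -> A^o) (N : set V) :
  (forall i, linear (f i)) -> is_submodule N ->
  (forall x, N x -> (forall i, (i < k)%N -> f i x = 0) -> x = 0) -> fin_gen N.
Proof.
move=> lin; elim: k N => [|k IH] N hN inj.
  exists [::]; apply/seteqP; split; last by apply: span_min.
  by move=> x Nx; rewrite (inj x Nx) //; case: (span_submod [set x : V | x \in [::]]).
apply: (@fin_gen_extension _ _ (f k)) => //.
  by apply: noethA; apply: image_submod.
apply: IH; first by apply: submod_setI => //; apply: ker_submod.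
move=> x [Nx fx] h; apply: inj => // i; rewrite ltnS leq_eqVlt.
by case/predU1P => [-> //|/h].
Qed.

Lemma rV_noetherian (n : nat) (N : set 'rV[A]_n) : is_submodule N -> fin_gen N.
Proof.
case: n N => [|n] N hN.
  have Z : forall x : 'rV[A]_0, x = 0 by move=> x; apply/rowP; case.
  exists [::]; apply/seteqP; split; last by apply: span_min.
  by move=> x _; rewrite (Z x); case: (span_submod [set x : 'rV[A]_0 | x \in [::]]).
pose f i : _ -> A^o := fun w : 'rV[A]_n.+1 => w 0 (inord i).
have lin i : linear (f i).
  by move=> a x y; rewrite /f !mxE.
apply: (fin_gen_functionals (k := n.+1) lin) => // x Nx h.
by apply/rowP => j; have := h j (ltn_ord j); rewrite /f inord_val mxE.
Qed.

(** The chain of ideals [L n] of leading coefficients stops growing, as its union [J] is finitely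
    generated. Past that degree a multiple of an element of [K] cancels the leading term, and [K] is
    finitely generated over [A]. *)
Lemma hilbert_basis : noetherian {poly A}.
Proof.
move=> I hI.
have IM p q : I p -> I (q * p) by move=> Ip; apply: (submod_scale q hI Ip).
have ID p q : I p -> I q -> I (p + q) by apply: submod_add.
have IB p q : I p -> I q -> I (p - q) by apply: submod_sub.
have IZ (a : A) (p : {poly A}) : I p -> I (a *: p) by rewrite -mul_polyC; apply: IM.
have I0 : I 0 by case: hI.
pose L n : set A^o := [set a | exists2 p : {poly A}, I p & (size p <= n.+1)%N /\ p`_n = a].
have hL n : is_submodule (L n).
  split; first by exists 0 => //; rewrite size_poly0 coef0.
  move=> a _ _ [p Ip [sp <-]] [q Iq [sq <-]]; exists (a *: p + q).
    by apply: ID => //; apply: IZ.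
  split; last by rewrite coefD coefZ.
  by apply: leq_trans (size_polyD _ _) _; rewrite geq_max sq (leq_trans (size_scale_leq _ _)).
have LS n : L n `<=` L n.+1.
  move=> _ [p Ip [sp <-]]; exists ('X * p); first exact: IM.
  by rewrite coefXM; split=> //; apply: leq_trans (size_polyMleq _ _) _; rewrite size_polyX.
have Lmono m n : (m <= n)%N -> L m `<=` L n.
  elim: n => [|n IH]; first by rewrite leqn0 => /eqP ->.
  by rewrite leq_eqVlt => /predU1P[-> //|/IH h a /h /LS].
pose J : set A^o := [set a | exists n, L n a].
have [s eJ] : fin_gen J.
  apply: noethA; split; first by exists 0%N; case: (hL 0%N).
  move=> a x y [m Lx] [n Ly]; exists (maxn m n); case: (hL (maxn m n)) => _; apply.
    by apply: Lmono Lx; apply: leq_maxl.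
  by apply: Lmono Ly; apply: leq_maxr.
have [n Jn] : exists n, J `<=` L n.
  have [|a sa|n h] := @uniform_bound _ s (fun n a => L n a).
  - by move=> m n a /Lmono; apply.
  - by have : J a by rewrite eJ; apply: sub_span.
  by exists n; rewrite eJ; apply: span_min.
pose K : set {poly A} := [set p | I p /\ (size p <= n.+1)%N].
have [t eK] : fin_gen K.
  pose f i : _ -> A^o := fun p : {poly A} => p`_i.
  have lin i : linear (f i).
    by move=> a x y; rewrite /f coefD coefZ.
  apply: (fin_gen_functionals (k := n.+1) lin).
    split; first by split=> //; rewrite size_poly0.
    move=> a p q [Ip sp] [Iq sq]; split; first by apply: ID => //; apply: IZ.
    by apply: leq_trans (size_polyD _ _) _; rewrite geq_max sq (leq_trans (size_scale_leq _ _)).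
  move=> p [_ sp] h; apply/polyP => i; rewrite coef0.
  by case: (ltnP i n.+1) => [/h //|ni]; rewrite nth_default // (leq_trans sp).
exists t; apply/seteqP; split; last first.
  apply: span_min => // p pt; have : K p by rewrite eK; apply: sub_span.
  by case.
have hT := @span_submod {poly A} {poly A}^o [set x | x \in t].
set T := span _ in hT *.
have KT p : K p -> T p.
  rewrite eK; apply: span_min; last exact: (@sub_span {poly A} {poly A}^o).
  split; first by case: hT.
  move=> a x y Tx Ty; apply: (submod_add hT) => //.
  by rewrite -mul_polyC; apply: (submod_scale (a%:P : {poly A}) hT Tx).
move=> p; have [k] := ubnP (size p); elim: k p => // k IH p pk Ip.
case: (leqP (size p) n.+1) => [sp|sp]; first exact: KT.
have [q Iq [sq lq]] : L n (lead_coef p).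
  apply: Jn; exists (size p).-1; exists p => //.
  by split=> //; rewrite prednK // (leq_trans _ sp).
pose d := ((size p).-1 - n)%N.
have dn : (d + n)%N = (size p).-1 by rewrite subnK // -ltnS prednK // (leq_trans _ sp) // ltnW.
rewrite -(subrK ('X^d * q) p); apply: (submod_add hT).
  apply: IH; last by apply: IB => //; apply: IM.
  have sp0 : (0 < size p)%N by apply: leq_trans sp.
  rewrite ltnS in pk; apply: leq_trans pk; rewrite -(prednK sp0) ltnS.
  (* At degree [(size p).-1] the two coefficients agree; above it both vanish. *)
  apply/leq_sizeP => j; rewrite leq_eqVlt => /predU1P[<-|hj].
    rewrite coefB coefXnM -{2 3}dn ltnNge leq_addr /= addKn lq.
    by rewrite /lead_coef subrr.
  rewrite coefB nth_default ?sub0r; last by rewrite -(prednK sp0).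
  rewrite coefXnM; case: ifP => [_|/negbT]; first by rewrite oppr0.
  rewrite -leqNgt => dj; rewrite nth_default ?oppr0 // (leq_trans sq) //.
  by rewrite -(ltn_add2l d) subnKC // dn.
apply: (submod_scale ('X^d : {poly A}) hT); apply: KT; split => //.
Qed.

End Noetherian.

(** [B] is built as an iterated polynomial ring, one variable per entry of [s], mapping onto the
    subalgebra generated by [s]. Finiteness is argued over [B], so the subalgebra need not become a
    type. The last clause is induction over the image. *)
Lemma noetherian_cover (A : comNzRingType) (S : comNzRingType)
    (iota : {rmorphism A -> S}) (s : seq S) : noetherian A ->
  exists (B : comNzRingType) (pi : {rmorphism B -> S}),
    [/\ noetherian B, forall a, exists b, pi b = iota a,
     forall x, x \in s -> exists b, pi b = x &
     forall Q : set S, (forall a, Q (iota a)) -> (forall x, x \in s -> Q x) ->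
       (forall x y, Q x -> Q y -> Q (x + y)) -> (forall x y, Q x -> Q y -> Q (x * y)) ->
       forall b, Q (pi b)].
Proof.
move=> nA; elim: s => [|x s [B [pi [nB iB sB QB]]]].
  by exists A, iota; split=> // a; exists a.
have cxp : commr_rmorph pi x by move=> b; apply: mulrC.
exists {poly B}, (horner_morph cxp); split; first exact: hilbert_basis.
- by move=> a; have [b <-] := iB a; exists b%:P; rewrite /= horner_morphC.
- move=> y; rewrite inE => /predU1P[->|/sB[b <-]].
    by exists 'X; rewrite /= horner_morphX.
  by exists b%:P; rewrite /= horner_morphC.
move=> Q Qi Qs QD QM; elim/poly_ind => [|p c IH]; first by rewrite rmorph0 -(rmorph0 iota).
have Qpi b : Q (pi b) by apply: QB => // y ys; apply: Qs; rewrite inE ys orbT.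
rewrite rmorphD rmorphM /= horner_morphX horner_morphC.
by apply: QD => //; apply: QM => //; apply: Qs; rewrite mem_head.
Qed.

(** * Annihilators, powers and stable elements *)

Section Polynomials.
Variables (A : comNzRingType) (r : nat).
Local Notation S := {mpoly A[r]}.
Implicit Types (P Q T : set S) (p q x y z : S).

(* Among the nonzero annihilators of P take one, g, with the fewest terms: a
   coefficient of some f in P that does not kill g would, for the largest such
   monomial of f, kill the leading coefficient of g, producing a shorter
   annihilator.  Hence every coefficient of g works. *)
Lemma mccoy P g : g != 0 -> (forall f, P f -> f * g = 0) ->
  exists2 c : A, c != 0 & forall f, P f -> c *: f = 0.
Proof.
have [k] := ubnP (size (msupp g)); elim: k g => // k IH g gk g0 Pg.
have [h|/existsNP[f /not_implyP[Pf /existsNP[m0 /eqP hm0]]]] :=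
  pselect (forall f, P f -> forall m, f@_m *: g = 0).
  exists (mleadc g); first by rewrite mleadc_eq0.
  move=> f Pf; apply/mpolyP => m; rewrite mcoeffZ mcoeff0 mulrC.
  by rewrite -mcoeffZ h // mcoeff0.
(* [f1] keeps the terms of [f] whose coefficients do not kill [g]. The other terms contribute
   nothing to [f * g], so [f1 * g = 0], although the leading coefficient of [f1] does not kill
   [g]. *)
have [f1 f1E] : exists f1, f1 = \sum_(m <- msupp f | f@_m *: g != 0) f@_m *: 'X_[m] by eexists.
have cf1 m : f1@_m = if f@_m *: g != 0 then f@_m else 0.
  rewrite f1E raddf_sum /=; under eq_bigr do rewrite mcoeffZ mcoeffX.
  have [mf|mf] := boolP (m \in msupp f).
    rewrite big_mkcond (bigD1_seq m) ?msupp_uniq //= eqxx mulr1 big1 ?addr0 // => m' /negPf mm'.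
    by rewrite mm' mulr0 if_same.
  rewrite (memN_msupp_eq0 mf) if_same big_seq_cond big1 // => m' /andP[m'f _].
  by case: eqP => [e|_]; rewrite ?mulr0 //; rewrite -e m'f in mf.
have f1g : f1 * g = 0.
  rewrite -(Pg f Pf) {1}(mpolyE f) mulr_suml (bigID (fun m => f@_m *: g != 0)) /=.
  rewrite f1E mulr_suml -[LHS]addr0; congr (_ + _); symmetry; apply: big1 => m.
  by rewrite negbK => /eqP e; rewrite -scalerAl mulrC scalerAl e mul0r.
have f10 : f1 != 0.
  by apply/eqP => e; have := cf1 m0; rewrite e mcoeff0 hm0 => e'; rewrite -e' scale0r eqxx in hm0.
pose a := mleadc f1.
have a0 : a != 0 by rewrite mleadc_eq0.
have ag : a *: g != 0.
  by move: a0; rewrite /a cf1; case: ifP => //; rewrite eqxx.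
have alg : a * mleadc g = 0 by rewrite -mleadcM f1g mcoeff0.
apply: (IH (a *: g)) => //; last first.
  by move=> h Ph; rewrite -scalerAr Pg // scaler0.
rewrite ltnS in gk; apply: leq_trans gk.
have ss : {subset msupp (a *: g) <= rem (mlead g) (msupp g)}.
  move=> m mag; rewrite mem_rem_uniq ?msupp_uniq // inE (msuppZ_le mag) andbT.
  apply: contraTneq mag => ->.
  by rewrite mcoeff_msupp mcoeffZ alg eqxx.
have lg := mlead_supp g0.
apply: leq_ltn_trans (uniq_leq_size (msupp_uniq _) ss) _.
by rewrite size_rem // prednK // -has_predT; apply/hasP; exists (mlead g).
Qed.

Lemma pihomogM_mem T n p q : is_submodule T ->
  (forall e d, (e + d)%N = n -> T (pihomog mdeg e p * pihomog mdeg d q)) ->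
  T (pihomog mdeg n (p * q)).
Proof.
move=> hT h; rewrite {1}(pihomog_partitionE (leqnn (mmeasure mdeg p))).
rewrite {1}(pihomog_partitionE (leqnn (mmeasure mdeg q))).
rewrite mulr_suml raddf_sum; apply: submod_sum => // i _.
rewrite mulr_sumr raddf_sum; apply: submod_sum => // j _ /=.
have hom : pihomog mdeg i p * pihomog mdeg j q \is (i + j)%N.-homog.
  by apply: dhomogM; apply: pihomogP.
have [e|ne] := eqVneq (i + j)%N n.
  by rewrite pihomog_dE -?e //; apply: h.
by rewrite (pihomog_ne0 ne) //; case: hT.
Qed.

Lemma pihomogMr p q d e : q \is e.-homog ->
  pihomog mdeg (d + e) (p * q) = pihomog mdeg d p * q.
Proof.
(* The bound exceeds [d], so that the component of degree [d] occurs in the sum even when [p] has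
   smaller degree. *)
move=> hq; rewrite {1}(pihomog_partitionE (leq_addr d.+1 (mmeasure mdeg p))).
have hi i : pihomog mdeg i p * q \is (i + e)%N.-homog.
  by apply: dhomogM => //; apply: pihomogP.
have dK : (d < mmeasure mdeg p + d.+1)%N by rewrite addnS ltnS leq_addl.
rewrite mulr_suml raddf_sum (bigD1 (Ordinal dK)) //= pihomog_dE // big1 ?addr0 // => i ne.
by rewrite (@pihomog_ne0 _ _ _ (i + e)%N) // eqn_add2r.
Qed.

Lemma pihomog_large p d : (mmeasure mdeg p <= d)%N -> pihomog mdeg d p = 0.
Proof.
move=> pd; rewrite (pihomog_partitionE (leqnn (mmeasure mdeg p))) raddf_sum.
rewrite big1 // => i _; apply: (@pihomog_ne0 _ _ _ i); last exact: pihomogP.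
by rewrite neq_ltn (leq_trans (ltn_ord i)).
Qed.

Lemma mul_submod T y : is_submodule T -> is_submodule [set x | T (x * y)].
Proof.
move=> [T0 hT]; split; first by rewrite /= mul0r.
by move=> a p q /= Tp Tq; rewrite mulrDl -scalerAl; apply: hT.
Qed.

Lemma homog_submod n : is_submodule [set x : S | x \is n.-homog].
Proof.
split; first exact: dhomog0.
by move=> a p q /= hp hq; apply: dhomogD => //; apply: dhomogZ.
Qed.

Lemma pow_submod P n : is_submodule (pow P n).
Proof. exact: span_submod. Qed.

Lemma pow_cst P a : pow P 0 a%:MP.
Proof.
rewrite -[a%:MP]mulr1 mul_mpolyC; apply/(submod_scale _ (pow_submod _ _))/sub_span.
by exists (fun=> 0); split; [case | rewrite big_ord0].
Qed.

Lemma sub_pow1 P : P `<=` pow P 1.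
Proof. by move=> p Pp; apply: sub_span; exists (fun=> p); rewrite big_ord1. Qed.

Lemma pow_mono P Q n : P `<=` Q -> pow P n `<=` pow Q n.
Proof.
move=> PQ; apply: span_mono => _ [f [Pf ->]].
by exists f; split=> // i; apply: PQ.
Qed.

Lemma powM P m n p q : pow P m p -> pow P n q -> pow P (m + n) (p * q).
Proof.
move=> Pp Pq; have hT := pow_submod P (m + n).
apply: (span_min (mul_submod q hT)) Pp => _ [f [Pf ->]] /=; rewrite mulrC.
apply: (span_min (mul_submod _ hT)) Pq => _ [g [Pg ->]] /=.
rewrite mulrC; apply: sub_span.
exists (fun i => match split i with inl j => f j | inr j => g j end); split.
  by move=> i; case: (split i).
rewrite big_split_ord; congr (_ * _); apply: eq_bigr => i _.
  by rewrite -[lshift _ _]/(unsplit (inl i)) unsplitK.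
by rewrite -[rshift _ _]/(unsplit (inr i)) unsplitK.
Qed.

Lemma pow0_min P T : is_submodule T -> T 1 -> pow P 0 `<=` T.
Proof. by move=> hT T1; apply: span_min => // _ [f [_ ->]]; rewrite big_ord0. Qed.

Lemma powD_min P m n T : is_submodule T ->
  (forall p q, pow P m p -> pow P n q -> T (p * q)) -> pow P (m + n) `<=` T.
Proof.
move=> hT h; apply: span_min => // _ [f [Pf ->]].
rewrite big_split_ord; apply: h; apply: sub_span.
  by exists (fun i => f (lshift n i)).
by exists (fun i => f (rshift m i)).
Qed.

Lemma powS_min P n T : is_submodule T ->
  (forall p q, P p -> pow P n q -> T (p * q)) -> pow P n.+1 `<=` T.
Proof.
move=> hT h; rewrite -add1n; apply: powD_min => // p q Pp Pq.
apply: (span_min (mul_submod q hT)) Pp => _ [f [Pf ->]] /=.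
by rewrite big_ord1; apply: h.
Qed.

Lemma pow_homog P n : P `<=` [set x | x \is 1.-homog] ->
  pow P n `<=` [set x | x \is n.-homog].
Proof.
move=> P1; elim: n => [|n IH].
  by apply: pow0_min; [exact: homog_submod | exact: dhomog1].
apply: powS_min; first exact: homog_submod.
by move=> p q /P1 Pp /IH Pq; rewrite /= -add1n; apply: dhomogM.
Qed.

Lemma pow_pow P n l : pow (pow P n) l = pow P (n * l).
Proof.
elim: l => [|l IH].
  rewrite muln0; apply/seteqP; split; apply: pow0_min; try exact: pow_submod;
  by rewrite -mpolyC1; apply: pow_cst.
rewrite mulnS; apply/seteqP; split.
  by apply: powS_min; [exact: pow_submod | rewrite IH; apply: powM].
apply: powD_min; first exact: pow_submod.
by rewrite -IH -add1n => p q /sub_pow1; apply: powM.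
Qed.

(* The E_n of the introductory comment, except that homogeneity is not imposed. *)
Definition stable P n : set S :=
  [set x | exists k, forall y, pow P k y -> pow P (n + k) (x * y)].

(** The [l - k] extra factors pass through the product. Hence witnesses of stability can be raised
    to a common exponent. *)
Lemma colon_shift P n k l x : (k <= l)%N ->
  (forall y, pow P k y -> pow P (n + k) (x * y)) ->
  forall y, pow P l y -> pow P (n + l) (x * y).
Proof.
move=> kl hx; under eq_forall do rewrite (mulrC x).
rewrite -(subnK kl); apply: powD_min; first exact/mul_submod/pow_submod.
move=> p q Pp Pq /=; rewrite -mulrA (mulrC q) addnCA.
by apply: powM => //; apply: hx.
Qed.

Lemma stable_submod P n : is_submodule (stable P n).
Proof.
split; first by exists 0%N => y _; rewrite mul0r; case: (pow_submod P (n + 0)).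
move=> a x y [k hx] [l hy]; exists (k + l)%N => z Pz.
rewrite mulrDl -scalerAl; case: (pow_submod P (n + (k + l))) => _; apply.
  exact: (colon_shift (leq_addr _ _) hx).
exact: (colon_shift (leq_addl _ _) hy).
Qed.

Lemma stableM P m n x y :
  stable P m x -> stable P n y -> stable P (m + n) (x * y).
Proof.
move=> [k hx] [l hy]; exists (k + l)%N => z Pz; rewrite -mulrA -addnA.
apply: (colon_shift _ hx); first by rewrite addnCA leq_addr.
exact: (colon_shift (leq_addl _ _) hy).
Qed.

Lemma pow_stable P Q n : P `<=` stable Q 1 -> pow P n `<=` stable Q n.
Proof.
move=> PQ; elim: n => [|n IH].
  apply: pow0_min; first exact: stable_submod.
  by exists 0%N => y; rewrite mul1r.
apply: powS_min; first exact: stable_submod.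
by move=> p q /PQ Pp /IH Pq; rewrite -add1n; apply: stableM.
Qed.

Lemma sub_stable P n : pow P n `<=` stable P n.
Proof. by move=> x Px; exists 0%N => y Py; apply: powM. Qed.

(** The closure of [pow P n] involves only exponents divisible by [n]. A witness [k] of stability is
    raised to [n * k.+1], which is at least [k] because [n] is positive. *)
Lemma ratliff_rush_pow P n : (0 < n)%N -> P `<=` [set x | x \is 1.-homog] ->
  ratliff_rush n (pow P n) = [set x | x \is n.-homog /\ stable P n x].
Proof.
move=> n0 P1; apply/seteqP; split=> x.
  move=> [l l0 [hx]]; rewrite !pow_pow mulnS => h.
  by split=> //; exists (n * l)%N.
move=> [hx [k h]]; exists k.+1 => //; split=> //.
rewrite !pow_pow [(n * k.+2)%N]mulnS; apply: (colon_shift _ h).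
by rewrite mulnS (leq_trans (leq_pmull k n0)) // leq_addl.
Qed.

End Polynomials.

(** * Stable elements of large degree *)

Section ReesAlgebra.
Variables (A : comNzRingType) (r : nat).
Local Notation S := {mpoly A[r]}.
Implicit Types (P Q : set S) (x y z : S).

(** Q P^l = P (Q P^(l-1)) lies in P Q^l = P^(l+1). Hence, inductively, Q^(n+1) = Q P^n = (Q P^l)
    P^(n-l) lies in P^(n+1). *)
Lemma pow_eq_ge P Q l n : P `<=` Q -> (0 < l)%N -> pow P l = pow Q l ->
  (l <= n)%N -> pow P n = pow Q n.
Proof.
case: l => // l PQ _ e; elim: n => // n IH; rewrite leq_eqVlt => /predU1P[<- //|ln].
apply/seteqP; split; first exact: pow_mono.
rewrite ltnS in ln; have step p : Q p -> pow P l.+1 `<=` [set q | pow P l.+2 (q * p)].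
  move=> Qp; apply: powS_min; first exact/mul_submod/pow_submod.
  move=> a b Pa Pb; rewrite /= -mulrA -add1n; apply: powM; first exact: sub_pow1.
  rewrite e -addn1; apply: powM; last exact: sub_pow1.
  exact: pow_mono Pb.
apply: powS_min; first exact: pow_submod.
move=> p q Qp; rewrite -IH // -(subnK ln) -addnS mulrC; move: q.
apply: powD_min; first exact/mul_submod/pow_submod.
by move=> u v Pu /(step p Qp) Pv; rewrite /= -mulrA; apply: powM.
Qed.

(** A witness can be raised beyond [n0], where the powers coincide. *)
Lemma stable1_eq P Q n0 : (forall n, (n0 <= n)%N -> pow P n = pow Q n) ->
  stable P 1 = stable Q 1.
Proof.
have sub P' Q' : (forall n, (n0 <= n)%N -> pow P' n = pow Q' n) ->
    stable P' 1 `<=` stable Q' 1.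
  move=> e x [k hx]; exists (maxn n0 k) => y.
  rewrite -!e ?leq_maxl //; last by rewrite (leq_trans (leq_maxl n0 k)) // leq_addl.
  by apply: (colon_shift _ hx); apply: leq_maxr.
by move=> e; apply/seteqP; split; apply: sub => // n /e.
Qed.

Hypothesis noethA : noetherian A.

(* The z with z P contained in the Rees algebra R form an R-module Z.  As P has no
   annihilator, z |-> (z p_i)_i embeds Z in a power of R, hence Z is generated
   over R by finitely many elements.  If D exceeds their degrees, then an element
   of degree n >= D is a combination of the generators with coefficients of
   positive degree, and P times a generator lies in R. *)
Lemma pow_colon_large P : fin_gen P -> P `<=` [set x | x \is 1.-homog] ->
  (forall g, (forall f, P f -> f * g = 0) -> g = 0) ->
  exists D, forall n z, (D <= n)%N -> z \is n.-homog ->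
    (forall p, P p -> pow P n.+1 (z * p)) -> pow P n z.
Proof.
move=> [s eP] P1 annP.
have sP x : x \in s -> P x by move=> xs; rewrite eP; apply: sub_span.
pose k := size s.
have sPi (i : 'I_k) : P s`_i by apply: sP; apply: mem_nth.
(* The image of [pi] is the Rees algebra of [P]; by [piR] and [pow_pi] it is graded, with the powers
   of [P] as components. *)
have [B [pi [nB iB sB QB]]] := noetherian_cover (@mpolyC r A) s noethA.
have piR b n : pow P n (pihomog mdeg n (pi b)).
  apply: (QB [set x | forall n, pow P n (pihomog mdeg n x)]) => //= {b n}.
  - move=> a n; have hom : (a%:MP : S) \is 0.-homog.
      by rewrite -[a%:MP]mulr1 mul_mpolyC; apply/dhomogZ/dhomog1.
    have [<-|ne] := eqVneq 0%N n; first by rewrite pihomog_dE //; apply: pow_cst.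
    by rewrite (pihomog_ne0 ne) //; case: (pow_submod P n).
  - move=> x xs n; have hom := P1 _ (sP x xs).
    have [<-|ne] := eqVneq 1%N n; first by rewrite pihomog_dE //; apply/sub_pow1/sP.
    by rewrite (pihomog_ne0 ne) //; case: (pow_submod P n).
  - by move=> x y hx hy n; rewrite raddfD; apply: submod_add => //; apply: pow_submod.
  - move=> x y hx hy n; apply: pihomogM_mem; first exact: pow_submod.
    by move=> e d <-; apply: powM.
have hpi : is_submodule [set x : S | exists b, pi b = x].
  split; first by exists 0; rewrite rmorph0.
  move=> a _ _ [b <-] [c <-]; have [d ed] := iB a.
  by exists (d * b + c); rewrite rmorphD rmorphM ed mul_mpolyC.
have pow_pi n : pow P n `<=` [set x | exists b, pi b = x].
  elim: n => [|n IH]; first by apply: pow0_min => //; exists 1; rewrite rmorph1.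
  apply: powS_min => // p q Pp /IH[c <-].
  have [b <-] : [set x : S | exists b, pi b = x] p.
    by move: Pp; rewrite eP; apply: (span_min hpi) => x /sB.
  by exists (b * c); rewrite rmorphM.
pose good D (w : 'rV[B]_k) := exists2 z, forall i : 'I_k, pi (w 0 i) = z * s`_i &
  forall n, (D <= n)%N -> pow P n (pihomog mdeg n z).
(* A row of [W] lifts to [B] the products of some element of Z with the generators of [P]; thus [W]
   is the preimage, in a free [B]-module, of the embedded Z. *)
pose W : set 'rV[B]_k := [set w | exists z, forall i : 'I_k, pi (w 0 i) = z * s`_i].
have [t eW] : fin_gen W.
  apply: rV_noetherian => //; split.
    by exists 0 => i; rewrite mxE rmorph0 mul0r.
  move=> b w w' [z hz] [z' hz']; exists (pi b * z + z') => i.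
  by rewrite !mxE rmorphD rmorphM hz hz' mulrDl mulrA.
have [||D goodD] := @uniform_bound _ t good.
- by move=> m n w mn [z hz hm]; exists z => // j nj; apply/hm/(leq_trans mn).
- move=> w wt; have [z hz] : W w by rewrite eW; apply: sub_span.
  exists (mmeasure mdeg z); exists z => // n /pihomog_large ->.
  by case: (pow_submod P n).
have W_good : W `<=` good D.
  rewrite eW; apply: span_min => //; split.
    exists 0 => [i|n _]; first by rewrite mxE rmorph0 mul0r.
    by rewrite raddf0; case: (pow_submod P n).
  move=> b w w' [z hz zD] [z' hz' z'D]; exists (pi b * z + z') => [i|n Dn].
    by rewrite !mxE rmorphD rmorphM hz hz' mulrDl mulrA.
  have hn := pow_submod P n.
  rewrite raddfD; apply: submod_add => //; last exact: z'D.
  apply: pihomogM_mem => // e d edn.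
  have [Dd|dD] := leqP D d; first by rewrite -edn; apply: powM; [exact: piR | exact: zD].
  (* Here [d < D <= n] forces [e > 0]. A factor from [P] can be taken out of the coefficient, and it
     multiplies the component of [z] into [pow P d.+1]. *)
  case: e edn => [|e] edn; first by rewrite -edn add0n leqNgt dD in Dn.
  apply: (@powS_min _ _ P e [set x | pow P n (x * _)]) (piR b e.+1); first exact: mul_submod.
  move=> p q Pp Pq; rewrite /= [p * q]mulrC -mulrA -edn addSnnS; apply: powM => //.
  have hd := mul_submod (pihomog mdeg d z) (pow_submod P d.+1).
  have Ps : span [set x | x \in s] p by rewrite -eP.
  apply: (span_min hd) Ps => x /= xs; rewrite mulrC.
  rewrite -(pihomogMr _ _ (P1 _ (sP x xs))).
  have xk : (index x s < k)%N by rewrite index_mem.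
  by have := hz (Ordinal xk); rewrite /= nth_index // => <-; rewrite addn1; apply: piR.
exists D => n z Dn hz zP.
have [|b hb] := @choice _ _ (fun (i : 'I_k) c => pi c = z * s`_i).
  by move=> i; apply: (pow_pi n.+1); apply: zP.
have [|z' hz' z'D] := W_good (\row_i b i).
  by exists z => i; rewrite mxE hb.
(* [z] and [z'] have the same products with the generators of [P], so [P] annihilates their
   difference. *)
suff e : z' - z = 0.
  by have := z'D n Dn; rewrite -(subrK z z') e add0r pihomog_dE.
apply: (annP (z' - z)) => f.
have hk : is_submodule [set f | f * (z' - z) = 0].
  apply: (@mul_submod A r [set x | x = 0]).
  by split=> // a u v /= -> ->; rewrite scaler0 addr0.
rewrite eP; apply: (span_min hk) => x /= xs.
have xk : (index x s < k)%N by rewrite index_mem.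
have := hz' (Ordinal xk); rewrite mxE hb /= nth_index // => e.
by rewrite mulrBr mulrC -e mulrC subrr.
Qed.

(** The exponent descends: if z P^(k+1) lies in P^(n+k+1) and q is in P^k, then z q has degree n + k
    >= D and multiplies P into P^(n+k+1), so z q lies in P^(n+k). *)
Lemma stable_large P : fin_gen P -> P `<=` [set x | x \is 1.-homog] ->
  (forall g, (forall f, P f -> f * g = 0) -> g = 0) ->
  exists D, forall n z, (D <= n)%N -> z \is n.-homog -> stable P n z -> pow P n z.
Proof.
move=> fP P1 annP; have [D hD] := pow_colon_large fP P1 annP.
exists D => n z Dn hz [k]; elim: k => [|k IH] zk.
  by have := zk 1; rewrite mulr1 addn0; apply; rewrite -mpolyC1; apply: pow_cst.
apply: IH => q Pq; apply: hD; first by rewrite (leq_trans Dn) // leq_addr.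
  by apply: dhomogM => //; apply: (pow_homog P1 Pq).
move=> p Pp; rewrite -mulrA -addnS; apply: zk.
by rewrite -addn1; apply: powM => //; apply: sub_pow1.
Qed.

End ReesAlgebra.

(** * Linear forms and Ratliff-Rush closures in F *)

Section LinearForms.
Variables (A : comNzRingType) (r : nat) (F : lmodType A).
Variable phi : {linear F -> 'rV[A]_r}.
Implicit Types (M N : set F).

Lemma lin_form_linear : linear (lin_form phi).
Proof.
move=> a x y; rewrite /lin_form scaler_sumr -big_split; apply: eq_bigr => i _.
by rewrite linearP !mxE scalerDl scalerA.
Qed.

Lemma lin_form_homog x : lin_form phi x \is 1.-homog.
Proof.
apply: rpred_sum => i _.
by apply: dhomogZ; rewrite dhomogX /= mdeg1.
Qed.

Lemma lin_form_inj : injective phi -> injective (lin_form phi).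
Proof.
move=> inj x y e; apply/inj/rowP => i.
have c z : (lin_form phi z)@_U_(i) = phi z 0 i.
  rewrite /lin_form raddf_sum (bigD1 i) //= big1 => [|j ji].
    by rewrite mcoeffZ mcoeffX eqxx mulr1 addr0.
  by rewrite mcoeffZ mcoeffX eq_mnm1 (negPf ji) mulr0.
by rewrite -!c e.
Qed.

(** By [mccoy] a nonzero annihilator yields a nonzero scalar killing the linear forms of [M], hence
    [M] itself since [phi] is injective. *)
Lemma faithful_annihilator M g : injective phi -> faithful M ->
  (forall f, (lin_form phi @` M) f -> f * g = 0) -> g = 0.
Proof.
move=> inj fM ann; apply/eqP; apply: contraT => g0.
have [c c0 hc] := mccoy g0 ann; case/eqP: c0; apply: fM => x Mx.
have l0 : lin_form phi 0 = 0 by exact: (ker_submod lin_form_linear).1.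
apply: (lin_form_inj inj); rewrite l0 -(hc (lin_form phi x)); last by exists x.
by have := lin_form_linear c x 0; rewrite l0 !addr0.
Qed.

Lemma mod_ratliff_rushE N :
  mod_ratliff_rush phi N = [set x | stable (lin_form phi @` N) 1 (lin_form phi x)].
Proof.
apply/seteqP; split=> x; first by move=> [l _ [_ h]]; exists l.
(* The closure asks for a positive exponent, whereas stability allows 0. *)
move=> [k h]; exists k.+1 => //; split; first exact: lin_form_homog.
exact: (colon_shift (leqnSn k) h).
Qed.

Lemma sub_mod_ratliff_rush N : N `<=` mod_ratliff_rush phi N.
Proof.
by move=> x Nx; rewrite mod_ratliff_rushE; apply/sub_stable/sub_pow1; exists x.
Qed.

Lemma mod_ratliff_rush_eq M N n0 :
  (forall n, (n0 <= n)%N -> mod_pow phi M n = mod_pow phi N n) ->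
  mod_ratliff_rush phi M = mod_ratliff_rush phi N.
Proof. by move=> /stable1_eq e; rewrite !mod_ratliff_rushE e. Qed.

End LinearForms.

Theorem proposition3p13 (A : comNzRingType) (r : nat) (F : lmodType A)
    (phi : {linear F -> 'rV[A]_r}) (M : set F) :
  noetherian A -> (0 < r)%N -> bijective phi ->
  is_submodule M -> fin_gen M -> faithful M ->
  [/\ exists n0 : nat, forall n : nat, (n0 <= n)%N ->
        ratliff_rush n (mod_pow phi M n) = mod_pow phi (mod_ratliff_rush phi M) n
        /\ mod_pow phi (mod_ratliff_rush phi M) n = mod_pow phi M n,
      forall N : set F, is_submodule N -> M `<=` N ->
        [<-> N `<=` mod_ratliff_rush phi M;
             exists2 l : nat, (0 < l)%N & mod_pow phi M l = mod_pow phi N l;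
             exists n0 : nat, forall n : nat, (n0 <= n)%N ->
               mod_pow phi M n = mod_pow phi N n;
             mod_ratliff_rush phi M = mod_ratliff_rush phi N]
    & mod_ratliff_rush phi (mod_ratliff_rush phi M) = mod_ratliff_rush phi M].
Proof.
move=> nA _ /bij_inj inj _ [s eM] fM.
have P1 : lin_form phi @` M `<=` [set x | x \is 1.-homog].
  by move=> _ [x _ <-]; apply: lin_form_homog.
have fP : fin_gen (lin_form phi @` M).
  exists (map (lin_form phi) s); rewrite eM image_span; last exact: lin_form_linear.
  congr span; apply/seteqP; split=> [_ [x xs <-]|_ /mapP[x xs ->]]; last by exists x.
  by rewrite /= map_f.
have [D hD] := stable_large nA fP P1 (fun g => faithful_annihilator inj fM).
(* The elements of N^n are forms of degree n that are stable for M, so they lie in M^n by the choice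
   of [D]. *)
have powRR N n : (D <= n)%N -> M `<=` N -> N `<=` mod_ratliff_rush phi M ->
    mod_pow phi M n = mod_pow phi N n.
  move=> Dn MN NM; apply/seteqP; split; first by apply: pow_mono; apply: image_subset.
  move=> z Nz; apply: hD => //.
    by apply: pow_homog Nz => _ [x _ <-]; apply: lin_form_homog.
  by apply: pow_stable Nz => _ [x /NM + <-]; rewrite mod_ratliff_rushE.
have MRR n : (D <= n)%N -> mod_pow phi M n = mod_pow phi (mod_ratliff_rush phi M) n.
  by move=> Dn; apply: powRR => //; apply: sub_mod_ratliff_rush.
(* Assertion (3) follows because [M] and its closure have equal powers from [D] on. *)
split; last by symmetry; apply: (@mod_ratliff_rush_eq _ _ _ _ _ _ D).
  (* [D.+1] makes [n] positive, as [ratliff_rush_pow] requires. *)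
  exists D.+1 => n Dn; have Dn' := ltnW Dn; rewrite -MRR //; split=> //.
  rewrite /mod_pow ratliff_rush_pow //; last exact: leq_ltn_trans Dn.
  apply/seteqP; split=> [x [hx]|x Px]; first exact: hD.
  by split; [apply: pow_homog Px | apply: sub_stable].
move=> N _ MN; tfae.
- by move=> NM; exists D.+1 => //; apply: powRR.
- move=> [l l0 e]; exists l => n; apply: pow_eq_ge => //.
  by apply: image_subset.
- by move=> [n0]; apply: mod_ratliff_rush_eq.
- by move=> ->; apply: sub_mod_ratliff_rush.
Qed.
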